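(* Let $X$ be a topological space and $f:X\to\mathbb R$ a Morse-type function, with induced map $\tilde f:\mathrm R_f(X)\to\mathbb R$ on its Reeb graph. For any gomics $\mathcal I,\mathcal J$, $$d_{\mathrm{Dg}(\tilde f)}(\mathcal I,\mathcal J)\le\max_{*\in\{O,E^-,R\}}d_H(Q_*^{\mathcal I},Q_*^{\mathcal J}),$$ where $d_H$ is the Hausdorff distance in the $\ell^\infty$-norm.
   Context: Homology is singular with coefficients in $\mathbb Z/2$; ''connected'' means path-connected. Morse type: a continuous $f:X\to\mathbb R$ is of Morse type if (i) there is a finite set $\mathrm{Crit}(f)=\{a_1<\dots<a_n\}$ such that, with $a_0=-\infty,a_{n+1}=+\infty$, for every $i=0,\dots,n$ there are a compact locally connected space $Y_i$ and a homeomorphism $\mu_i:Y_i\times(a_i,a_{i+1})\to f^{-1}((a_i,a_{i+1}))$ with $f\circ\mu_i$ equal to the projection onto the second factor; (ii) each $\mu_i$ extends to a continuous map $\bar\mu_i:Y_i\times([a_i,a_{i+1}]\cap\mathbb R)\to f^{-1}([a_i,a_{i+1}]\cap\mathbb R)$; (iii) every level set of $f$ has finitely generated homology. Extended persistence diagram: let $\mathbb R^{op}=\{\tilde x:x\in\mathbb R\}$ with reversed order and $\mathbb R_{Ext}=\mathbb R\cup\{+\infty\}\cup\mathbb R^{op}$, ordered by $\alpha<+\infty<\tilde\beta$. Put $F_\alpha=f^{-1}((-\infty,\alpha])$, $F_{+\infty}=X$, $F_{\tilde\alpha}=(X,f^{-1}([\alpha,+\infty)))$. Applying $H_*$ gives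 the extended persistence module, which for Morse-type functions is a finite direct sum of interval modules $\mathbb I[b,d)$. $\mathrm{Dg}(f)$ is the multiset of points $(b,d)$, where elements of $\mathbb R^{op}$ are plotted as the corresponding reals. Points with both coordinates in $\mathbb R$ are ordinary ($\mathrm{Ord}$), both in $\mathbb R^{op}$ relative ($\mathrm{Rel}$), abscissa in $\mathbb R$ and ordinate in $\mathbb R^{op}$ extended ($\mathrm{Ext}$). Reeb graph: $x\sim_f y$ iff $f(x)=f(y)$ and $x,y$ lie in the same connected component of $f^{-1}(f(x))$; $\mathrm R_f(X)=X/\sim_f$, and $\tilde f$ satisfies $f=\tilde f\circ\pi$ with $\pi$ the quotient map. Gomic: a cover $\mathcal I$ of $Z\subseteq\mathbb R$ (here, of $\mathrm{im}(f)$) by open intervals of $Z$ (sets $J\cap Z$, $J$ an open interval of $\mathbb R$) that is minimal (no element is contained in the union of the others) and generic (no connected component of a proper subset $\tilde I=I\setminus\bigcup_{I'\ne I}I'$ is a singleton). Then $\tilde I$ is an interval, at most two elements intersect at a time, elements are totally ordered, and $I=I_\cap^-\sqcup\tilde I\sqcup I_\cap^+$, where $I_\cap^-$ (resp. $I_\cap^+$) is the intersection of $I$ with the element right below (resp. above) it, empty if there is none. Staircases: for an interval $I$ with endpoints $a\le b$ let $Q_I^+=\{a\le x\le y\le b\}$, $Q_I^-=\{a\le y<x\le b\}$, and $Q_O^{\mathcal I}=\bigcup_I Q^+_{\tilde I\cup I_\cap^+}$, $Q_R^{\mathcal I}=\bigcup_I Q^-_{\tilde I\cup I_\cap^-}$,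 $Q_{E^-}^{\mathcal I}=\bigcup_I Q_I^-$. For a persistence diagram $\mathrm{Dg}$ and gomics $\mathcal I,\mathcal J$, $$d_{\mathrm{Dg}}(\mathcal I,\mathcal J)=\max_{*\in\{O,E^-,R\}}\ \sup_{p\in\mathrm{Dg}^*\cap(Q_*^{\mathcal I}\triangle Q_*^{\mathcal J})}\max\{d_\infty(p,Q_*^{\mathcal I}),d_\infty(p,Q_*^{\mathcal J})\},$$ where $\triangle$ is the symmetric difference, $d_\infty$ the $\ell^\infty$-distance, $\mathrm{Dg}^*$ is the subdiagram $\mathrm{Ord}$, $\mathrm{Ext}$, $\mathrm{Rel}$ for $*=O,E^-,R$ respectively, and the supremum over the empty set is $0$. *)

(* Defs.v *)
From HB Require Import structures.
From mathcomp Require Import all_boot all_order all_algebra.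
From mathcomp Require Import all_classical all_reals ereal topology normedtype.
From mathcomp.multinomials Require Import freeg.

Set Implicit Arguments.
Unset Strict Implicit.
Unset Printing Implicit Defensive.

Import Order.TTheory GRing.Theory Num.Theory.
Import numFieldNormedType.Exports.

Local Open Scope classical_set_scope.
Local Open Scope ring_scope.
Local Open Scope quotient_scope.

(* MathComp provides quotients of Z-modules only; we add the scalar action. *)
Section QuotientModule.
Context {K : nzRingType} {V : lmodType K} (S : submodClosed V).

Definition submod_pred : {pred V} := S.

Lemma submod_pred_zmod_closed : zmod_closed submod_pred.
Proof.
split=> [|u v Su Sv]; first exact: (rpred0 S).
by rewrite -scaleN1r; apply: (@rpredD _ S) => //; apply: (@rpredZ _ _ S).
Qed.

HB.instance Definition _ :=
  GRing.isZmodClosed.Build V submod_pred submod_pred_zmod_closed.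

Definition quot_lmod : Type := Quotient.quot submod_pred.

HB.instance Definition _ := GRing.Zmodule.on quot_lmod.

Definition quot_pi (v : V) : quot_lmod := \pi_(Quotient.quot submod_pred) v.
Definition quot_repr (q : quot_lmod) : V :=
  repr (q : Quotient.quot submod_pred).

Lemma quot_reprK : cancel quot_repr quot_pi.
Proof. by move=> q; rewrite /quot_pi /quot_repr reprK. Qed.

Lemma quot_piE (u v : V) : (quot_pi u == quot_pi v) = (u - v \in S).
Proof. exact/esym/(Quotient.idealrBE submod_pred). Qed.

Lemma quot_piD : {morph quot_pi : u v / u + v}.
Proof. by move=> u v; rewrite /quot_pi raddfD. Qed.

Definition quot_scale (a : K) (q : quot_lmod) : quot_lmod :=
  quot_pi (a *: quot_repr q).

Lemma quot_scale_pi a v : quot_scale a (quot_pi v) = quot_pi (a *: v).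
Proof.
apply/eqP; rewrite quot_piE -scalerBr; apply: rpredZ.
by rewrite -quot_piE quot_reprK.
Qed.

Lemma quot_scaleA a b q : quot_scale a (quot_scale b q) = quot_scale (a * b) q.
Proof. by rewrite -[q]quot_reprK !quot_scale_pi scalerA. Qed.

Lemma quot_scale1 : left_id 1 quot_scale.
Proof. by move=> q; rewrite -[q]quot_reprK quot_scale_pi scale1r. Qed.

Lemma quot_scaleDr : right_distributive quot_scale +%R.
Proof.
move=> a p q; rewrite -[p]quot_reprK -[q]quot_reprK.
by rewrite -quot_piD !quot_scale_pi scalerDr quot_piD.
Qed.

Lemma quot_scaleDl q : {morph quot_scale^~ q : a b / a + b}.
Proof.
by move=> a b; rewrite -[q]quot_reprK !quot_scale_pi scalerDl quot_piD.
Qed.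

HB.instance Definition _ := GRing.Zmodule_isLmodule.Build K quot_lmod
  quot_scaleA quot_scale1 quot_scaleDr quot_scaleDl.

Lemma quot_pi_linear : linear quot_pi.
Proof. by move=> a u v; rewrite quot_piD -quot_scale_pi. Qed.

HB.instance Definition _ := GRing.isLinear.Build K V quot_lmod *:%R quot_pi
  quot_pi_linear.
End QuotientModule.

Section QuotientMap.
Context {K : nzRingType} {V W : lmodType K}.
Variables (S : submodClosed V) (T : submodClosed W) (f : {linear V -> W}).
Hypothesis fST : forall v, v \in S -> f v \in T.

Definition quot_map (q : quot_lmod S) : quot_lmod T :=
  quot_pi T (f (quot_repr q)).

Lemma quot_mapE v : quot_map (quot_pi S v) = quot_pi T (f v).
Proof.
apply/eqP; rewrite quot_piE -linearB fST//.
by rewrite -quot_piE quot_reprK.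
Qed.

Lemma quot_map_linear : linear quot_map.
Proof.
move=> a p q; rewrite -[p]quot_reprK -[q]quot_reprK -linearP.
by rewrite !quot_mapE !linearP.
Qed.
End QuotientMap.

Arguments quot_map {K V W} S T f q.

Definition fin_gen (K : nzRingType) (V : lmodType K) : Prop :=
  exists s : seq V, forall v : V, exists c : 'I_(size s) -> K,
    v = \sum_(i < size s) c i *: s`_i.

Section StandardSimplex.
Context {R : realType}.

Definition simplex (n : nat) : set 'rV[R]_n.+1 :=
  [set x | (forall i, 0 <= x ord0 i) /\ \sum_i x ord0 i = 1].

Definition insert0 n (i : 'I_n.+2) (x : 'rV[R]_n.+1) : 'rV[R]_n.+2 :=
  \row_j (if unlift i j is Some k then x ord0 k else 0).

Lemma insert0_simplex n (i : 'I_n.+2) (x : 'rV[R]_n.+1) :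
  simplex x -> simplex (insert0 i x).
Proof.
move=> [x0 x1]; split=> [j|]; first by rewrite mxE; case: unlift.
rewrite (bigD1_ord i)//= mxE unlift_none add0r -[RHS]x1.
by apply: eq_bigr => j _; rewrite mxE liftK.
Qed.

Lemma insert0_continuous n (i : 'I_n.+2) : continuous (@insert0 n i).
Proof.
move=> x; have xF := nbhs_filter x; apply/cvg_ballP => e e0.
apply: (@filterS _ _ _ (ball x e)) => [y [_ xy]|]; last first.
  exact: (@nbhsx_ballx R 'rV[R]_n.+1 x e e0).
split=> // k j; rewrite !mxE.
by case: unlift => [l|]; [exact: xy | exact: ballxx].
Qed.

Definition coface n (i : 'I_n.+2) (x : @simplex n) : @simplex n.+1 :=
  exist _ (insert0 i (set_val x)) (mem_set (insert0_simplex i (set_valP x))).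

Lemma coface_continuous n (i : 'I_n.+2) : continuous (coface i).
Proof.
apply: continuous_comp_initial => x.
apply: (@continuous_comp _ _ _ set_val (insert0 i)).
  exact: initial_continuous.
exact: insert0_continuous.
Qed.

HB.instance Definition _ n (i : 'I_n.+2) :=
  isContinuous.Build _ _ (coface i) (@coface_continuous n i).
End StandardSimplex.

Section SingularHomology.
Context {R : realType} {X : topologicalType}.

(* Singular simplices of all dimensions are put together, so that the homology
   of the resulting chain complex is the whole of H_* = \bigoplus_n H_n. *)
Definition sing := {n : nat & continuousType (@simplex R n) X}.

Definition sing_image (s : sing) : set X := range (projT2 s).

Definition sing_chain := {freeg sing / 'F_2}.

(* No signs, since the coefficients are in Z/2. *)
Definition bd_sing (s : sing) : sing_chain :=
  match s with
  | existT 0 _ => 0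
  | existT n.+1 g =>
      \sum_(i < n.+2) << existT _ n (g \o coface i : continuousType _ _) >>
  end.

Definition bd : sing_chain -> sing_chain := fglift bd_sing.

Lemma bd_linear : linear bd.
Proof.
have bdB : {morph bd : c d / c - d} by exact: lift_is_additive.
have bd0 : bd 0 = 0 by have := bdB 0 0; rewrite !subrr.
have bdN : {morph bd : c / - c}.
  by move=> c; have := bdB 0 c; rewrite bd0 !sub0r.
have bdD : {morph bd : c d / c + d}.
  by move=> c d; rewrite -{1}(opprK d) bdB bdN opprK.
move=> a c d; rewrite bdD; congr (_ + _).
have bd_sum (I : Type) (r : seq I) (F : I -> sing_chain) :
    bd (\sum_(i <- r) F i) = \sum_(i <- r) bd (F i) by exact: big_morph.
rewrite -[in RHS](freeg_sumE c) [a *: c]/(fgscale a c) /fgscale !bd_sum.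
rewrite scaler_sumr.
by apply: eq_bigr => s _; rewrite /bd !liftU scalerA.
Qed.

HB.instance Definition _ :=
  GRing.isLinear.Build 'F_2 sing_chain sing_chain *:%R bd bd_linear.

Definition chain_in (U : set X) (c : sing_chain) : Prop :=
  forall s, coeff s c != 0 -> sing_image s `<=` U.

Lemma chain_in0 U : chain_in U 0.
Proof. by move=> s; rewrite coeff0 eqxx. Qed.

Lemma chain_inP U a c d : chain_in U c -> chain_in U d ->
  chain_in U (a *: c + d).
Proof.
move=> Uc Ud s; rewrite coeffD coeffZ.
have [c0|c0 _] := eqVneq (coeff s c) 0; last exact: Uc.
by rewrite c0 mulr0 add0r; exact: Ud.
Qed.

Lemma chain_inS U U' c : U `<=` U' -> chain_in U c -> chain_in U' c.
Proof. by move=> UU' Uc s /Uc sU; exact: subset_trans UU'. Qed.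

Section Pair.
Variables U A : set X.

Definition cycle_pred : {pred sing_chain} :=
  [pred c | `[< chain_in U c /\ chain_in A (bd c) >]].

Lemma cycle_predP c :
  reflect (chain_in U c /\ chain_in A (bd c)) (c \in cycle_pred).
Proof. exact: asboolP. Qed.

Lemma cycle_submod_closed : submod_closed cycle_pred.
Proof.
split=> [|a c d /cycle_predP[Uc Ac] /cycle_predP[Ud Ad]]; apply/cycle_predP.
  by rewrite linear0; split; exact: chain_in0.
by rewrite linearP; split; exact: chain_inP.
Qed.

HB.instance Definition _ :=
  GRing.isSubmodClosed.Build 'F_2 sing_chain cycle_pred cycle_submod_closed.

Definition rel_cycle := {c : sing_chain | c \in cycle_pred}.

HB.instance Definition _ := SubChoice.on rel_cycle.
HB.instance Definition _ := [SubChoice_isSubLmodule of rel_cycle by <:].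

Definition rel_boundary : {pred rel_cycle} :=
  [pred z | `[< exists c d,
    [/\ chain_in U c, chain_in A d & val z = bd c + d] >]].

Lemma boundaryP z :
  reflect (exists c d, [/\ chain_in U c, chain_in A d & val z = bd c + d])
          (z \in rel_boundary).
Proof. exact: asboolP. Qed.

Lemma boundary_submod_closed : submod_closed rel_boundary.
Proof.
split=> [|a y z /boundaryP[c [d [Uc Ad yE]]] /boundaryP[c' [d' [Uc' Ad' zE]]]];
    apply/boundaryP.
  by exists 0, 0; rewrite !linear0 addr0; split=> //; exact: chain_in0.
exists (a *: c + c'), (a *: d + d'); split; [exact: chain_inP..|].
by rewrite !linearP/= yE zE scalerDr addrACA.
Qed.

HB.instance Definition _ :=
  GRing.isSubmodClosed.Build 'F_2 rel_cycle rel_boundary boundary_submod_closed.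

(* H_*(U, A; Z/2) for A `<=` U, with H_*(U) = homology U set0. *)
Definition homology : lmodType 'F_2 := quot_lmod rel_boundary.
End Pair.

Arguments rel_boundary U A : clear implicits.

Section Inclusion.
Variables (U A U' A' : set X) (UU' : U `<=` U') (AA' : A `<=` A').

Lemma cycle_incl_subproof (z : rel_cycle U A) : val z \in cycle_pred U' A'.
Proof.
apply/cycle_predP; have /cycle_predP[Uz Az] := valP z.
by split; [exact: chain_inS Uz|exact: chain_inS Az].
Qed.

Definition cycle_incl (z : rel_cycle U A) : rel_cycle U' A' :=
  exist _ (val z) (cycle_incl_subproof z).

Lemma cycle_incl_linear : linear cycle_incl.
Proof. by move=> a y z; exact: val_inj. Qed.

HB.instance Definition _ :=
  GRing.isLinear.Build 'F_2 (rel_cycle U A) (rel_cycle U' A') *:%R cycle_incl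
    cycle_incl_linear.

Lemma cycle_incl_boundary z : z \in rel_boundary U A ->
  cycle_incl z \in rel_boundary U' A'.
Proof.
move=> /boundaryP[c [d [Uc Ad zE]]]; apply/boundaryP; exists c, d.
by split=> //; [exact: chain_inS Uc|exact: chain_inS Ad].
Qed.

Definition homology_incl : homology U A -> homology U' A' :=
  quot_map (rel_boundary U A) (rel_boundary U' A') cycle_incl.

HB.instance Definition _ :=
  GRing.isLinear.Build 'F_2 (homology U A) (homology U' A') *:%R homology_incl
    (quot_map_linear cycle_incl_boundary).

Lemma homology_inclE z :
  homology_incl (quot_pi (rel_boundary U A) z) =
  quot_pi (rel_boundary U' A') (cycle_incl z).
Proof. exact: (quot_mapE cycle_incl_boundary). Qed.
End Inclusion.

Lemma homology_incl_id (U A : set X) (UU : U `<=` U) (AA : A `<=` A) :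
  homology_incl UU AA =1 id.
Proof.
move=> v; rewrite -[v]quot_reprK homology_inclE; congr quot_pi.
exact: val_inj.
Qed.

Lemma homology_incl_comp (U A U' A' U2 A2 : set X)
    (s : U `<=` U') (s' : A `<=` A') (t : U' `<=` U2) (t' : A' `<=` A2)
    (u : U `<=` U2) (u' : A `<=` A2) v :
  homology_incl t t' (homology_incl s s' v) = homology_incl u u' v.
Proof.
rewrite -[v]quot_reprK !homology_inclE; congr quot_pi.
exact: val_inj.
Qed.
End SingularHomology.

Section PathConnected.
Context {R : realType} {T : topologicalType}.

Definition path_component (A : set T) (x y : T) : Prop :=
  exists g : R -> T, [/\ {within `[0, 1], continuous g},
    forall t : R, 0 <= t <= 1 -> A (g t), g 0 = x & g 1 = y].

Definition path_connected (A : set T) : Prop :=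
  forall x y, A x -> A y -> path_component A x y.

Definition locally_path_connected : Prop :=
  forall (x : T) (U : set T), nbhs x U ->
    exists V : set T, [/\ open V, V x, V `<=` U & path_connected V].

Lemma path_reparam (g : R -> T) (h : R -> R) :
  {within `[0, 1], continuous g} -> continuous h ->
  (forall t, 0 <= h t <= 1) -> continuous (g \o h).
Proof.
move=> /subspace_sigL_continuousP gc hc h01.
have hI t : h t \in `[0, 1]%classic by rewrite inE/= in_itv/= h01.
have -> : g \o h = sigL `[0, 1]%classic g \o (fun t => exist _ (h t) (hI t)).
  by apply/funext => t.
move=> t; apply: continuous_comp; last exact: gc.
by apply: continuous_comp_initial; exact: hc.
Qed.

Definition clamp (t : R) : R := Num.max 0 (Num.min 1 t).

Lemma clamp01 t : 0 <= clamp t <= 1.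
Proof. by rewrite /clamp le_max lexx/= ge_max ler01/= ge_min lexx. Qed.

Lemma clampE t : 0 <= t <= 1 -> clamp t = t.
Proof. by move=> /andP[t0 t1]; rewrite /clamp min_r// max_r. Qed.

Lemma clamp_continuous (h : R -> R) : continuous h -> continuous (clamp \o h).
Proof.
move=> hc t; apply: (@continuous_max R R (fun=> 0) (fun s => Num.min 1 (h s))).
  exact: cvg_cst.
by apply: (@continuous_min R R (fun=> 1) h); [exact: cvg_cst|exact: hc].
Qed.

Lemma path_component_refl (A : set T) x : A x -> path_component A x x.
Proof.
exists (fun=> x); split=> //.
by apply: continuous_subspaceT => t; exact: cvg_cst.
Qed.

Lemma path_component_sym (A : set T) x y :
  path_component A x y -> path_component A y x.
Proof.
move=> [g [gc gA g0 g1]]; exists (g \o (clamp \o (fun t => 1 - t))); split.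
- apply: continuous_subspaceT; apply: path_reparam => //; last first.
    by move=> t; exact: clamp01.
  apply: clamp_continuous => t; apply: cvgB; first exact: cvg_cst.
  exact: cvg_id.
- by move=> t _; apply: gA; exact: clamp01.
- by rewrite /= subr0 clampE// ler01 lexx.
- by rewrite /= subrr clampE// ler01 lexx.
Qed.

Lemma path_component_trans (A : set T) x y z :
  path_component A x y -> path_component A y z -> path_component A x z.
Proof.
move=> [g [gc gA g0 g1]] [h [hc hA h0 h1]].
pose g' := g \o (clamp \o (fun t : R => t *+ 2)).
pose h' := h \o (clamp \o (fun t : R => t *+ 2 - 1)).
have g'c : continuous g'.
  apply: path_reparam => // [|t]; last exact: clamp01.
  apply: clamp_continuous => t; rewrite /continuous_at mulr2n.
  under eq_fun do rewrite mulr2n.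
  by apply: cvgD; exact: cvg_id.
have h'c : continuous h'.
  apply: path_reparam => // [|t]; last exact: clamp01.
  apply: clamp_continuous => t; rewrite /continuous_at mulr2n.
  under eq_fun do rewrite mulr2n.
  by apply: cvgB; [apply: cvgD; exact: cvg_id|exact: cvg_cst].
have half2 : (2^-1 : R) *+ 2 = 1 by rewrite -[LHS]mulr_natl mulfV ?pnatr_eq0.
pose k t := if t <= 2^-1 then g' t else h' t.
exists k; split.
- have -> : `[(0 : R), 1]%classic = `[0, 2^-1] `|` `[2^-1, 1].
    apply/seteqP; split=> t /=; rewrite !in_itv/=.
      move=> /andP[-> ->]; rewrite andbT/=.
      by case: (leP t 2^-1) => [|/ltW] ?; [left|right].
    have h1' : (2^-1 : R) <= 1 by rewrite invf_le1// ler1n.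
    case=> /andP[t0 t1]; first by rewrite t0 (le_trans t1).
    by rewrite t1 (le_trans _ t0)// invr_ge0.
  apply: withinU_continuous; [exact: interval_closed..| |].
    apply: (@subspace_eq_continuous _ _ _ g' k); last first.
      exact: continuous_subspaceT.
    by move=> t; rewrite inE/= in_itv/= => /andP[_ t2]; rewrite /k t2.
  apply: (@subspace_eq_continuous _ _ _ h' k); last first.
    exact: continuous_subspaceT.
  move=> t; rewrite inE/= in_itv/= => /andP[t2 _].
  rewrite /k; case: (leP t 2^-1) => // t2'.
  have -> : t = 2^-1 by apply/eqP; rewrite eq_le t2'.
  rewrite /g' /h' /= half2 subrr !clampE ?lexx ?ler01//.
  by rewrite g1 h0.
- move=> t _; rewrite /k.
  by case: ifP => _; [apply: gA|apply: hA]; exact: clamp01.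
- by rewrite /k invr_ge0 ler0n /g' /= mul0rn clampE ?lexx ?ler01.
- rewrite /k leNgt invf_lt1 ?ltr1n//= /h' /= mulr2n addrK clampE ?lexx ?ler01//.
Qed.
End PathConnected.

Arguments path_component R {T} A x y.
Arguments path_connected R {T} A.
Arguments locally_path_connected R T : clear implicits.
Arguments homology R {X} U A.

(* "Connected" means path-connected throughout. *)
Section ReebGraph.
Context {R : realType} {X : topologicalType} (f : X -> R).

Definition reeb_rel (x y : X) : bool :=
  `[< f x = f y /\ path_component R (f @^-1` [set f x]) x y >].

Lemma reeb_relP x y :
  reflect (f x = f y /\ path_component R (f @^-1` [set f x]) x y)
          (reeb_rel x y).
Proof. exact: asboolP. Qed.

Lemma reeb_rel_equiv : equiv_class_of reeb_rel.
Proof.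
split=> [x|x y|y x z].
- by apply/reeb_relP; split=> //; exact: path_component_refl.
- by apply/reeb_relP/reeb_relP => -[<-] /path_component_sym.
- move=> /reeb_relP[fxy xy] /reeb_relP[fyz yz]; apply/reeb_relP.
  split; first by rewrite fxy.
  by apply: path_component_trans xy _; rewrite fxy.
Qed.

Canonical reeb_equiv_rel := EquivRelPack reeb_rel_equiv.

Definition reeb_graph : topologicalType :=
  quotient_topology {eq_quot reeb_equiv_rel}.

Definition reeb_pi (x : X) : reeb_graph := \pi_({eq_quot reeb_equiv_rel}) x.

Definition reeb_map (q : reeb_graph) : R :=
  f (repr (q : {eq_quot reeb_equiv_rel})).

Lemma reeb_mapE x : f x = reeb_map (reeb_pi x).
Proof.
have /eqP/eqmodP/reeb_relP[] //= :
  x == repr (reeb_pi x) %[mod {eq_quot reeb_equiv_rel}] by rewrite reprK.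
Qed.
End ReebGraph.

Arguments reeb_map {R X} f q.

Definition homeomorphism (S T : topologicalType) (g : S -> T) : Prop :=
  continuous g /\ exists h : T -> S, [/\ continuous h, cancel g h & cancel h g].

Section MorseType.
Context {R : realType} {X : topologicalType}.

(* a_0 = -oo, a_1, ..., a_n, a_(n+1) = +oo *)
Definition crit_bound (a : seq R) (i : nat) : \bar R :=
  nth +oo%E (-oo%E :: map EFin a) i.

Definition open_slab (a : seq R) (i : nat) : set R :=
  [set t | crit_bound a i < t%:E < crit_bound a i.+1]%E.

Definition closed_slab (a : seq R) (i : nat) : set R :=
  [set t | crit_bound a i <= t%:E <= crit_bound a i.+1]%E.

Definition morse_type (f : X -> R) : Prop :=
  [/\ continuous f,
    exists a : seq R, sorted <%R a /\
      forall i, (i <= size a)%N -> exists (Y : topologicalType)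
          (mu : Y * open_slab a i -> f @^-1` open_slab a i),
        [/\ compact [set: Y], locally_path_connected R Y, homeomorphism mu,
          forall y t, f (set_val (mu (y, t))) = set_val t &
          exists mubar : Y * closed_slab a i -> f @^-1` closed_slab a i,
            continuous mubar /\
            forall y (t : open_slab a i) (t' : closed_slab a i),
              set_val t' = set_val t :> R ->
              set_val (mubar (y, t')) = set_val (mu (y, t)) :> X] &
    forall r : R, fin_gen (homology R (f @^-1` [set r]) set0)].
End MorseType.

Section ExtendedLine.
Context {R : realType}.

(* Op x stands for the element of R^op usually written x with a tilde. *)
Inductive rext := Fin of R | Infty | Op of R.

HB.instance Definition _ := gen_eqMixin rext.

Definition rext_le (s t : rext) : bool :=
  match s, t with
  | Fin x, Fin y => x <= y
  | Fin _, _ => true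
  | Infty, Fin _ => false
  | Infty, _ => true
  | Op x, Op y => y <= x
  | Op _, _ => false
  end.

Definition rext_lt (s t : rext) : bool := ~~ rext_le t s.

Lemma rext_le_refl : reflexive rext_le.
Proof. by case=> //= x. Qed.

Lemma rext_le_trans : transitive rext_le.
Proof.
case=> [y||y] [x||x] [z||z] //=; first exact: le_trans.
by move=> yx /le_trans; exact.
Qed.
End ExtendedLine.

Arguments rext : clear implicits.

(* Functors from the poset R_Ext to vector spaces over Z/2. *)
Record persmod (R : realType) := Persmod {
  pm_obj :> rext R -> lmodType 'F_2;
  pm_map : forall s t, rext_le s t -> {linear pm_obj s -> pm_obj t};
  pm_map1 : forall s (ss : rext_le s s) v, pm_map ss v = v;
  pm_map_comp : forall s t u (st : rext_le s t) (tu : rext_le t u)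
    (su : rext_le s u) v, pm_map tu (pm_map st v) = pm_map su v
}.

Definition persmod_iso (R : realType) (M N : persmod R) : Prop :=
  exists phi : forall t, {linear M t -> N t},
    (forall t, bijective (phi t)) /\
    forall s t (st : rext_le s t) v,
      phi t (pm_map M st v) = pm_map N st (phi s v).

Section DirectSum.
Context {R : realType}.

Definition persmod0 : persmod R :=
  @Persmod R (fun=> 'rV['F_2]_0) (fun s t _ => idfun) (fun _ _ _ => erefl)
    (fun _ _ _ _ _ _ _ => erefl).

Section Binary.
Variables M N : persmod R.

Definition sum_obj (t : rext R) : lmodType 'F_2 := (M t * N t)%type.

Definition sum_map s t (st : rext_le s t) (v : sum_obj s) : sum_obj t :=
  (pm_map M st v.1, pm_map N st v.2).

Lemma sum_map_linear s t (st : rext_le s t) : linear (sum_map st).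
Proof. by move=> a u v; rewrite /sum_map !linearP. Qed.

HB.instance Definition _ s t (st : rext_le s t) :=
  GRing.isLinear.Build 'F_2 (sum_obj s) (sum_obj t) *:%R (sum_map st)
    (sum_map_linear st).

Program Definition persmod_add : persmod R :=
  @Persmod R sum_obj (fun s t st => sum_map st) _ _.
Next Obligation. by move=> s ss [u v]; congr pair; exact: pm_map1. Qed.
Next Obligation.
by move=> s t u st tu su [v w]; congr pair; exact: pm_map_comp.
Qed.
End Binary.

Lemma const_mx1_id (m : bool) (v : 'rV['F_2]_m) : v *m const_mx 1 = v.
Proof.
case: m v => v; last by rewrite [RHS]thinmx0 [LHS]thinmx0.
by apply/rowP => i; rewrite mxE big_ord1 mxE mulr1 (ord1 i).
Qed.

Lemma const_mx1_comp (m n k : bool) (v : 'rV['F_2]_m) : (m -> k -> n) ->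
  v *m (const_mx 1 : 'M_(m, n)) *m const_mx 1 = v *m (const_mx 1 : 'M_(m, k)).
Proof.
case: m v => v; last by rewrite [v]thinmx0 !mul0mx.
case: k => [/(_ isT isT)|_]; last by rewrite [LHS]thinmx0 [RHS]thinmx0.
by case: n => // _; rewrite const_mx1_id.
Qed.

Section Interval.
Variables b d : rext R.

Definition in_interval (t : rext R) : bool := rext_le b t && rext_lt t d.

(* 'F_2 when t lies in [b, d), and 0 otherwise. *)
Definition interval_obj (t : rext R) : lmodType 'F_2 :=
  'rV['F_2]_(in_interval t).

(* Between two copies of 'F_2 this is the identity. *)
Definition interval_map s t (st : rext_le s t) (v : interval_obj s) :
  interval_obj t := v *m const_mx 1.

Lemma interval_map_linear s t (st : rext_le s t) : linear (interval_map st).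
Proof. by move=> a u v; rewrite /interval_map mulmxDl scalemxAl. Qed.

HB.instance Definition _ s t (st : rext_le s t) :=
  GRing.isLinear.Build 'F_2 (interval_obj s) (interval_obj t) *:%R
    (interval_map st) (interval_map_linear st).

Lemma in_interval_convex s t u : rext_le s t -> rext_le t u ->
  in_interval s -> in_interval u -> in_interval t.
Proof.
move=> st tu /andP[bs _] /andP[_ ud].
rewrite /in_interval (rext_le_trans bs)//=.
by apply: contraNN ud => /rext_le_trans; exact.
Qed.

Lemma interval_map1 s (ss : rext_le s s) : interval_map ss =1 id.
Proof. by move=> v; exact: const_mx1_id. Qed.

Lemma interval_map_comp s t u (st : rext_le s t) (tu : rext_le t u)
    (su : rext_le s u) v :
  interval_map tu (interval_map st v) = interval_map su v.
Proof. exact/const_mx1_comp/in_interval_convex. Qed.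

Definition interval_module : persmod R :=
  @Persmod R interval_obj (fun s t st => interval_map st)
    interval_map1 interval_map_comp.
End Interval.

Definition interval_sum (D : seq (rext R * rext R)) : persmod R :=
  foldr (fun p M => persmod_add (interval_module p.1 p.2) M) persmod0 D.
End DirectSum.

Section ExtendedPersistence.
Context {R : realType} {X : topologicalType} (f : X -> R).

Definition filt_space (t : rext R) : set X :=
  if t is Fin a then [set x | f x <= a] else setT.

Definition filt_sub (t : rext R) : set X :=
  if t is Op a then [set x | a <= f x] else set0.

Lemma filt_spaceS s t : rext_le s t -> filt_space s `<=` filt_space t.
Proof. by case: s t => [a||a] [b||b] //= ab x /le_trans; exact. Qed.

Lemma filt_subS s t : rext_le s t -> filt_sub s `<=` filt_sub t.
Proof. by case: s t => [a||a] [b||b] //= ab x //=; exact: le_trans ab. Qed.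

Definition ext_persmod : persmod R :=
  @Persmod R (fun t => homology R (filt_space t) (filt_sub t))
    (fun s t st => homology_incl (filt_spaceS st) (filt_subS st))
    (fun s ss => homology_incl_id _ _)
    (fun s t u st tu su => homology_incl_comp _ _ _ _ _ _).

(* The finite multiset Dg(f) is represented by a list, up to permutation. *)
Definition is_diagram (D : seq (rext R * rext R)) : Prop :=
  all (fun p => rext_lt p.1 p.2) D /\
  persmod_iso ext_persmod (interval_sum D).
End ExtendedPersistence.

Section Diagram.
Context {R : realType} (D : seq (rext R * rext R)).

Definition Ord_pts : set (R * R) := [set p | (Fin p.1, Fin p.2) \in D].
Definition Rel_pts : set (R * R) := [set p | (Op p.1, Op p.2) \in D].
Definition Ext_pts : set (R * R) := [set p | (Fin p.1, Op p.2) \in D].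
End Diagram.

Section Gomic.
Context {R : realType}.
Implicit Types (F : set (set R)) (I J Z : set R).

Definition open_interval_of Z I : Prop :=
  exists J, [/\ open J, is_interval J & I = J `&` Z].

Definition proper_subpart F I : set R := I `\` \bigcup_(I' in F `\ I) I'.

Definition gomic Z F : Prop :=
  [/\ F `<=` open_interval_of Z,
    \bigcup_(I in F) I = Z,
    forall I, F I -> ~ (I `<=` \bigcup_(I' in F `\ I) I') &
    forall I, F I -> forall x, proper_subpart F I x ->
      path_component R (proper_subpart F I) x <> [set x]].

(* The elements of a gomic are ordered as their proper subparts, which are
   nonempty, pairwise disjoint and order-convex in Z. *)
Definition below F I I' : Prop :=
  forall x y, proper_subpart F I x -> proper_subpart F I' y -> x < y.

(* I is right below I'. *)
Definition right_below F I I' : Prop :=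
  [/\ F I, F I', I <> I', below F I I' &
    ~ exists J, [/\ F J, J <> I, J <> I', below F I J & below F J I']].

Definition inter_below F I : set R :=
  I `&` \bigcup_(I' in [set I' | right_below F I' I]) I'.

Definition inter_above F I : set R :=
  I `&` \bigcup_(I' in [set I' | right_below F I I']) I'.

(* Endpoints are extended reals: intervals may be unbounded. *)
Definition lend I : \bar R := ereal_inf (EFin @` I).
Definition rend I : \bar R := ereal_sup (EFin @` I).

Definition Qplus I : set (R * R) :=
  [set p | [/\ lend I <= p.1%:E, p.1%:E <= p.2%:E & p.2%:E <= rend I]%E].

Definition Qminus I : set (R * R) :=
  [set p | [/\ lend I <= p.2%:E, p.2%:E < p.1%:E & p.1%:E <= rend I]%E].

Definition Q_O F : set (R * R) :=
  \bigcup_(I in F) Qplus (proper_subpart F I `|` inter_above F I).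

Definition Q_R F : set (R * R) :=
  \bigcup_(I in F) Qminus (proper_subpart F I `|` inter_below F I).

Definition Q_Em F : set (R * R) := \bigcup_(I in F) Qminus I.
End Gomic.

Section Distances.
Context {R : realType}.
Implicit Types (p : R * R) (P Q : set (R * R)).
Local Open Scope ereal_scope.

(* The norm of R * R is the maximum norm. *)
Definition dist_inf p Q : \bar R := ereal_inf [set `|p - q|%:E | q in Q].

(* Supremum of a set of nonnegative extended reals, equal to 0 on set0. *)
Definition nnsup (A : set (\bar R)) : \bar R := ereal_sup (0 |` A).

Definition hausdorff_dist P Q : \bar R :=
  maxe (nnsup [set dist_inf p Q | p in P]) (nnsup [set dist_inf q P | q in Q]).

Definition diagram_dist (Dg P Q : set (R * R)) : \bar R :=
  nnsup [set maxe (dist_inf p P) (dist_inf p Q) |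
         p in Dg `&` ((P `\` Q) `|` (Q `\` P))].

Definition gomic_dist (D : seq (rext R * rext R)) (F G : set (set R)) :
    \bar R :=
  maxe (diagram_dist (Ord_pts D) (Q_O F) (Q_O G))
    (maxe (diagram_dist (Ext_pts D) (Q_Em F) (Q_Em G))
          (diagram_dist (Rel_pts D) (Q_R F) (Q_R G))).
End Distances.

(* Main.v *)
Require Import Defs.
From mathcomp Require Import all_boot all_order all_algebra.
From mathcomp Require Import all_classical all_reals ereal topology normedtype.

(** A point of the symmetric difference of two sets P and Q lies in one of
    them, say P.  Its distance to P is then 0, and its distance to Q is one of
    the numbers whose supremum is taken in the Hausdorff distance.  So the
    larger of the two distances is at most the Hausdorff distance, whichever
    diagram the point is taken from ([diagram_dist_le_hausdorff]).  The
    inequality of the theorem is the maximum of three instances of this one, for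
    the staircases of the ordinary, extended and relative points. *)

Import Order.TTheory GRing.Theory Num.Theory.
Local Open Scope classical_set_scope.
Local Open Scope ereal_scope.

Section StaircaseDistances.
Context {R : realType}.
Implicit Types (p : R * R) (P Q Dg : set (R * R)).

Lemma dist_inf_ge0 p Q : 0 <= dist_inf p Q.
Proof. by apply: le_ereal_inf_tmp => _ [q _ <-]; rewrite lee_fin. Qed.

Lemma dist_inf_mem p P : P p -> dist_inf p P = 0.
Proof.
move=> Pp; apply/eqP; rewrite eq_le dist_inf_ge0 andbT.
by apply: ereal_inf_lbound; exists p; rewrite // subrr normr0.
Qed.

Lemma hausdorff_dist_sym P Q : hausdorff_dist P Q = hausdorff_dist Q P.
Proof. exact: maxC. Qed.

Lemma max_dist_inf_le_hausdorff P Q p : P p ->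
  maxe (dist_inf p P) (dist_inf p Q) <= hausdorff_dist P Q.
Proof.
move=> Pp; rewrite dist_inf_mem// max_r ?dist_inf_ge0// le_max.
by apply/orP; left; apply: ereal_sup_ubound; right; exists p.
Qed.

Lemma diagram_dist_le_hausdorff Dg P Q :
  diagram_dist Dg P Q <= hausdorff_dist P Q.
Proof.
apply: ge_ereal_sup => _ [->|[p [_ [[Pp _]|[Qp _]]] <-]].
- by rewrite le_max; apply/orP; left; apply: ereal_sup_ubound; left.
- exact: max_dist_inf_le_hausdorff.
- by rewrite maxC hausdorff_dist_sym; exact: max_dist_inf_le_hausdorff.
Qed.

End StaircaseDistances.

Local Close Scope ereal_scope.
Local Close Scope classical_set_scope.

Theorem theorem6p1 (R : realType) (X : topologicalType) (f : X -> R)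
    (Hf : morse_type f)
    (D : seq (rext R * rext R)) (HD : is_diagram (reeb_map f) D)
    (F G : set (set R)) (HF : gomic (range f) F) (HG : gomic (range f) G) :
  (gomic_dist D F G <=
     maxe (hausdorff_dist (Q_O F) (Q_O G))
       (maxe (hausdorff_dist (Q_Em F) (Q_Em G))
             (hausdorff_dist (Q_R F) (Q_R G))))%E.
Proof.
apply: le_max2; first exact: diagram_dist_le_hausdorff.
by apply: le_max2; exact: diagram_dist_le_hausdorff.
Qed.
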